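(* Let $w_1,w_2,w_3$ be positive integers, $n\ge0$ an integer, and $y_1\in\mathbb{Z}_p$. Then \begin{align*} &(w_1w_2)^{n-1}\sum_{i=0}^{w_1-1}\sum_{j=0}^{w_2-1}q^{w_2w_3i+w_1w_3j}B_{n,q^{w_1w_2}}\Big(w_3y_1+\frac{w_3}{w_1}i+\frac{w_3}{w_2}j\Big)\\ &=(w_2w_3)^{n-1}\sum_{i=0}^{w_2-1}\sum_{j=0}^{w_3-1}q^{w_1w_3i+w_1w_2j}B_{n,q^{w_2w_3}}\Big(w_1y_1+\frac{w_1}{w_2}i+\frac{w_1}{w_3}j\Big)\\ &=(w_3w_1)^{n-1}\sum_{i=0}^{w_3-1}\sum_{j=0}^{w_1-1}q^{w_1w_2i+w_2w_3j}B_{n,q^{w_1w_3}}\Big(w_2y_1+\frac{w_2}{w_3}i+\frac{w_2}{w_1}j\Big). \end{align*}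
   Context: Let $p$ be a prime, $\mathbb{C}_p$ the completion of an algebraic closure of $\mathbb{Q}_p$, and $|\cdot|_p$ the absolute value on $\mathbb{C}_p$ with $|p|_p=1/p$. Fix $q\in\mathbb{C}_p$ with $q\neq 1$ and $|q-1|_p<p^{-1/(p-1)}$; for every positive integer $w$, $Q=q^w$ also satisfies these conditions. For such $Q$, the $Q$-Bernoulli numbers are defined by $\frac{\log Q+t}{Qe^t-1}=\sum_{n\ge0}B_{n,Q}\frac{t^n}{n!}$ ($\log$ the $p$-adic logarithm), and the $Q$-Bernoulli polynomials by $\frac{\log Q+t}{Qe^t-1}e^{xt}=\sum_{n\ge0}B_{n,Q}(x)\frac{t^n}{n!}$, i.e. $B_{n,Q}(x)=\sum_{j=0}^n\binom{n}{j}B_{j,Q}x^{n-j}$ (a polynomial, evaluated at elements of $\mathbb{C}_p$). *)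

(* Defs.v *)
From HB Require Import structures.
From mathcomp Require Import all_boot all_order all_algebra.
From mathcomp Require Import all_classical all_reals all_analysis.
From mathcomp Require Import ring.
Set Implicit Arguments.
Unset Strict Implicit.
Unset Printing Implicit Defensive.
Import Order.TTheory GRing.Theory Num.Theory.
Local Open Scope classical_set_scope.
Local Open Scope ring_scope.

(* The normed structures of MathComp-Analysis are archimedean (the norm of
   x *+ n is n times that of x), so the notions below are stated directly for a
   real-valued function abs on a field. *)

Definition abs_cvg (R : realType) (K : fieldType) (abs : K -> R)
    (u : nat -> K) (l : K) : Prop :=
  forall e : R, 0 < e -> exists N, forall n, (N <= n)%N -> abs (u n - l) < e.

Definition abs_cauchy (R : realType) (K : fieldType) (abs : K -> R)
    (u : nat -> K) : Prop :=
  forall e : R, 0 < e ->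
    exists N, forall m n, (N <= m)%N -> (N <= n)%N -> abs (u m - u n) < e.

Definition abs_closure (R : realType) (K : fieldType) (abs : K -> R)
    (A : set K) : set K :=
  [set x | forall e : R, 0 < e -> exists2 y, A y & abs (x - y) < e].

(* In a complete extension of Q carrying the p-adic absolute value, the
   completion Q_p of Q is the topological closure of Q. *)
Definition padicQ (R : realType) (K : fieldType) (abs : K -> R) : set K :=
  abs_closure abs (range (fun r : rat => ratr r : K)).

Definition padicZ (R : realType) (K : fieldType) (abs : K -> R) : set K :=
  [set x | padicQ abs x /\ abs x <= 1].

Definition padicQbar (R : realType) (K : fieldType) (abs : K -> R) : set K :=
  [set x | exists f : {poly K},
     [/\ f != 0, forall i, padicQ abs f`_i & root f x]].

(* (K, abs) is the completion of an algebraic closure of Q_p, with |p| = 1/p;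
   this determines (K, abs) up to isometric isomorphism. Being ultrametric with
   |p| = 1/p, abs restricts to the p-adic absolute value on Q. *)
Record is_Cp (R : realType) (p : nat) (K : fieldType) (abs : K -> R) : Prop :=
  IsCp {
    Cp_abs_ge0 : forall x, 0 <= abs x;
    Cp_abs_eq0 : forall x, abs x = 0 <-> x = 0;
    Cp_absM : forall x y, abs (x * y) = abs x * abs y;
    Cp_absD : forall x y, abs (x + y) <= Num.max (abs x) (abs y);
    Cp_absp : abs p%:R = p%:R^-1;
    Cp_complete : forall u, abs_cauchy abs u -> exists l, abs_cvg abs u l;
    Cp_Qbar_closed : forall f : {poly K},
      (1 < size f)%N -> (forall i, padicQbar abs f`_i) ->
      exists2 x, padicQbar abs x & root f x;
    Cp_Qbar_dense : abs_closure abs (padicQbar abs) = setT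
  }.

(* log z = \sum_(k >= 1) (-1)^(k+1) (z - 1)^k / k, convergent for |z - 1| < 1;
   the value is 0 when the series diverges. *)
Definition plog (R : realType) (K : fieldType) (abs : K -> R) (z : K) : K :=
  xget 0 [set l | abs_cvg abs
    (fun N => \sum_(1 <= k < N.+1) (-1) ^+ k.+1 * (z - 1) ^+ k / k%:R) l].

(* A formal power series \sum_n f_n t^n is the sequence f of its coefficients. *)

Definition ps_mul (K : fieldType) (f g : nat -> K) : nat -> K :=
  fun n => \sum_(k < n.+1) f k * g (n - k)%N.

(* The first n + 1 coefficients of 1/f, from g_0 = 1/f_0 and
   g_(n+1) = - (\sum_(k <= n) f_(k+1) g_(n-k)) / f_0. *)
Fixpoint ps_inv_seq (K : fieldType) (f : nat -> K) (n : nat) : seq K :=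
  if n is m.+1 then
    let s := ps_inv_seq f m in
    rcons s (- (f 0%N)^-1 * \sum_(k < m.+1) f k.+1 * s`_(m - k))
  else [:: (f 0%N)^-1].

Definition ps_inv (K : fieldType) (f : nat -> K) : nat -> K :=
  fun n => (ps_inv_seq f n)`_n.

(* e^(x t) *)
Definition ps_exp (K : fieldType) (x : K) : nat -> K :=
  fun n => x ^+ n / n`!%:R.

(* (log Q + t) / (Q e^t - 1) *)
Definition qbern_gen (R : realType) (K : fieldType) (abs : K -> R) (Q : K) :
    nat -> K :=
  ps_mul (fun n => plog abs Q *+ (n == 0%N) + 1 *+ (n == 1%N))
    (ps_inv (fun n => Q * ps_exp 1 n - 1 *+ (n == 0%N))).

Definition qbern (R : realType) (K : fieldType) (abs : K -> R) (Q : K)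
    (n : nat) : K :=
  n`!%:R * qbern_gen abs Q n.

Definition qbern_poly (R : realType) (K : fieldType) (abs : K -> R) (Q : K)
    (n : nat) : {poly K} :=
  \sum_(j < n.+1) ('C(n, j)%:R * qbern abs Q j) *: 'X^(n - j).

Lemma size_ps_inv_seq (K : fieldType) (f : nat -> K) n :
  size (ps_inv_seq f n) = n.+1.
Proof. by elim: n => //= n IH; rewrite size_rcons IH. Qed.

Lemma nth_ps_inv_seq (K : fieldType) (f : nat -> K) n i :
  (i <= n)%N -> (ps_inv_seq f n)`_i = ps_inv f i.
Proof.
elim: n => [|n IH]; first by rewrite leqn0 => /eqP ->.
rewrite leq_eqVlt => /predU1P[-> //|lt_in].
by rewrite /= nth_rcons size_ps_inv_seq lt_in IH.
Qed.

Lemma ps_mulV (K : fieldType) (f : nat -> K) :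
  f 0%N != 0 -> ps_mul f (ps_inv f) = fun n => 1 *+ (n == 0%N).
Proof.
move=> f0; apply/funext => -[|n]; rewrite /ps_mul.
  by rewrite big_ord_recl big_ord0 addr0 /ps_inv /= divff.
rewrite big_ord_recl /= subn0 {1}/ps_inv /= nth_rcons size_ps_inv_seq ltnn eqxx.
rewrite mulrA mulrN divff // mulN1r addrC; apply/eqP; rewrite subr_eq0.
apply/eqP; apply: eq_bigr => k _.
by rewrite nth_ps_inv_seq ?leq_subr.
Qed.

Lemma Cp_char0 (R : realType) (p : nat) (K : fieldType) (abs : K -> R) :
  prime p -> is_Cp p abs -> forall n, n.+1%:R != 0 :> K.
Proof.
move=> p_pr CK n; have pgt1 := prime_gt1 p_pr.
have abs1 : abs 1 = 1.
  have a1 : abs 1 != 0 by apply/eqP => /(Cp_abs_eq0 CK)/eqP; rewrite oner_eq0.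
  by apply: (mulfI a1); rewrite -(Cp_absM CK) !mulr1.
have absn m : abs m%:R <= 1.
  elim: m => [|m IH]; first by rewrite (proj2 (Cp_abs_eq0 CK 0)).
  rewrite -natr1; apply: le_trans (Cp_absD CK _ _) _.
  by rewrite abs1 ge_max IH lexx.
have absN x : abs (- x) = abs x.
  have : abs (-1) ^+ 2 = 1 by rewrite expr2 -(Cp_absM CK) mulrNN mulr1.
  move/eqP; rewrite sqrf_eq1 => /orP[] /eqP h.
    by rewrite -mulN1r (Cp_absM CK) h mul1r.
  by have := Cp_abs_ge0 CK (-1); rewrite h oppr_ge0 ler10.
have p0 : p%:R != 0 :> K.
  apply/eqP => /(Cp_abs_eq0 CK)/eqP; rewrite (Cp_absp CK) invr_eq0 pnatr_eq0.
  by rewrite -leqn0 leqNgt (ltnW pgt1).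
have [m ndvd ->] := pfactor_coprime p_pr (ltn0Sn n).
rewrite natrM natrX mulf_neq0 ?expf_neq0 //; apply/eqP => m0.
have mgt0 : (0 < m)%N by case: (m) ndvd => //; rewrite /coprime gcdn0; case: (p) pgt1 => [|[]].
have [a b e _] := egcdnP p mgt0.
move: ndvd; rewrite coprime_sym => /eqP ndvd; rewrite ndvd in e.
have : a%:R * m%:R = b%:R * p%:R + 1 :> K by rewrite -natrM e natrD natrM.
rewrite m0 mulr0 => /esym/eqP; rewrite addr_eq0 => /eqP/(congr1 abs).
rewrite absN abs1 (Cp_absM CK) (Cp_absp CK) => h.
have : abs b%:R / p%:R < 1.
  rewrite ltr_pdivrMr ?ltr0n ?prime_gt0 // mul1r.
  by apply: le_lt_trans (absn b) _; rewrite ltr1n.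
by rewrite h ltxx.
Qed.

(* (log Q + t) / (Q e^t - 1) * e^(x t) = \sum_n B_(n,Q)(x) t^n / n! *)
Lemma qbern_polyE (R : realType) (p : nat) (K : fieldType) (abs : K -> R)
    (Q x : K) : prime p -> is_Cp p abs ->
  ps_mul (qbern_gen abs Q) (ps_exp x) =
  fun n => (qbern_poly abs Q n).[x] / n`!%:R.
Proof.
move=> p_pr CK; apply/funext => n.
have f0 k : k`!%:R != 0 :> K.
  by rewrite -(prednK (fact_gt0 k)); exact: Cp_char0 p_pr CK _.
rewrite /qbern_poly horner_sum mulr_suml; apply: eq_bigr => -[j jn] _ /=.
rewrite hornerZ hornerXn /qbern /ps_exp.
apply: (mulIf (f0 n)); rewrite mulfVK //.
have := bin_fact (n := n) (m := j) jn => <-; rewrite !natrM.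
set A := _`!%:R; set B := _`!%:R; set C := _%:R; set D := qbern_gen _ _ _.
have B0 : B != 0 := f0 _.
by field.
Qed.

(* Main.v *)
(** Put E = q e^t. Multiplied by t^n / n! and summed over n, the expression in
    (w1, w2, w3) becomes
    (log q + t) e^(w1 w2 w3 y t) (E^(w1 w2 w3) - 1)^2
      / ((E^(w1 w2) - 1) (E^(w2 w3) - 1) (E^(w1 w3) - 1)),
    because log (q^w) = w log q and the two inner sums are geometric; this is
    symmetric in the w's. The denominator is invertible because q^w <> 1 for
    w > 0: for z <> 1 with |z - 1| < p^(-1/(p-1)) and l prime, l is the dominant
    term of (z^l - 1) / (z - 1), so z^l <> 1.

    For log (z^w) = w log z, let L_N be the N-th partial sum of log (1 + X).
    Since (1 + X) L_N' = 1 - (-X)^N, the polynomial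
    P = L_N ((1 + X)^w - 1) - w L_N satisfies X^N | (1 + X) P', so
    P = O(X^(N+1)); its coefficients have absolute value at most N, so
    |P(x)| <= N |x|^N, which tends to 0 for |x| < 1. *)

Require Import Defs.
From HB Require Import structures.
From mathcomp Require Import all_boot all_order all_algebra.
From mathcomp Require Import all_classical all_reals all_analysis.
From mathcomp Require Import ring lra.
Set Implicit Arguments.
Unset Strict Implicit.
Unset Printing Implicit Defensive.
Import Order.TTheory GRing.Theory Num.Theory.
Local Open Scope ring_scope.

(* An alias, so that the Cauchy product does not clash with the pointwise ring
   structure of nat -> K. *)
Definition fps (K : fieldType) : Type := nat -> K.

(** * Formal power series under the Cauchy product: ring structure, dilation, exponentials *)

Section PowerSeries.
Variable K : fieldType.
Implicit Types f g h : fps K.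

HB.instance Definition _ := Choice.on (fps K).

Definition fps_add f g : fps K := fun n => f n + g n.
Definition fps_opp f : fps K := fun n => - f n.
Definition fps0 : fps K := fun=> 0.

Fact fps_addA : associative fps_add.
Proof. by move=> f g h; apply/funext => n; rewrite /fps_add addrA. Qed.
Fact fps_addC : commutative fps_add.
Proof. by move=> f g; apply/funext => n; rewrite /fps_add addrC. Qed.
Fact fps_add0 : left_id fps0 fps_add.
Proof. by move=> f; apply/funext => n; rewrite /fps_add add0r. Qed.
Fact fps_addN : left_inverse fps0 fps_opp fps_add.
Proof. by move=> f; apply/funext => n; rewrite /fps_add addNr. Qed.
HB.instance Definition _ :=
  GRing.isZmodule.Build (fps K) fps_addA fps_addC fps_add0 fps_addN.

Definition fps_const (c : K) : fps K := fun n => c *+ (n == 0%N).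

Definition fps_mul f g : fps K := ps_mul f g.

(** A coefficient of a Cauchy product depends only on truncations of the factors; this lets
    associativity and commutativity be inherited from [{poly K}]. *)
Lemma ps_mulE (N n : nat) f g : (n < N)%N ->
  ps_mul f g n = ((\poly_(i < N) f i) * (\poly_(i < N) g i))`_n.
Proof.
move=> nN; rewrite coefM; apply: eq_bigr => -[k kn] _ /=; rewrite !coef_poly.
by rewrite !(leq_ltn_trans _ nN) ?leq_subr.
Qed.

Fact fps_mulA : associative fps_mul.
Proof.
move=> f g h; apply/funext => n; transitivity
  ((\poly_(i < n.+1) f i * \poly_(i < n.+1) g i * \poly_(i < n.+1) h i)`_n).
  rewrite -mulrA coefM; apply: eq_bigr => -[k kn] _ /=.
  by rewrite coef_poly kn -ps_mulE // ltnS leq_subr.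
rewrite coefM; apply: eq_bigr => -[k kn] _ /=.
by rewrite coef_poly ltnS leq_subr -ps_mulE.
Qed.
Fact fps_mulC : commutative fps_mul.
Proof.
by move=> f g; apply/funext => n; rewrite /fps_mul !(ps_mulE _ _ (ltnSn n)) mulrC.
Qed.
Fact fps_mul1 : left_id (fps_const 1) fps_mul.
Proof.
move=> f; apply/funext => n; rewrite /fps_mul /ps_mul big_ord_recl subn0 mul1r.
by rewrite big1 ?addr0 // => i _; rewrite mul0r.
Qed.
Fact fps_mulDl : left_distributive fps_mul +%R.
Proof.
move=> f g h; apply/funext => n; rewrite /fps_mul /ps_mul /GRing.add /= /fps_add.
by rewrite -big_split; apply: eq_bigr => i _; rewrite mulrDl.
Qed.
Fact fps_1neq0 : fps_const 1 != 0 :> fps K.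
Proof. by apply/eqP => /(congr1 (fun f => f 0%N))/eqP; rewrite oner_eq0. Qed.
HB.instance Definition _ := GRing.Zmodule_isComNzRing.Build (fps K)
  fps_mulA fps_mulC fps_mul1 fps_mulDl fps_1neq0.

Lemma fpsDE f g n : (f + g) n = f n + g n. Proof. by []. Qed.
Lemma fpsNE f n : (- f) n = - f n. Proof. by []. Qed.
Lemma fpsME f g : f * g = ps_mul f g. Proof. by []. Qed.
Lemma fps1E n : (1 : fps K) n = 1 *+ (n == 0%N). Proof. by []. Qed.

Lemma fps_sumE (I : Type) (r : seq I) (P : pred I) (F : I -> fps K) n :
  (\sum_(i <- r | P i) F i) n = \sum_(i <- r | P i) F i n.
Proof. exact: (big_morph (fun f : fps K => f n) (fun f g => fpsDE f g n)). Qed.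

Lemma fpsM0 f g : (f * g) 0%N = f 0%N * g 0%N.
Proof. by rewrite fpsME /ps_mul big_ord_recl big_ord0 addr0. Qed.

Lemma fps_constM c f n : (fps_const c * f) n = c * f n.
Proof.
rewrite fpsME /ps_mul big_ord_recl subn0 big1 ?addr0 // => i _.
by rewrite mul0r.
Qed.

Lemma fps_const_mul a b : fps_const (a * b) = fps_const a * fps_const b.
Proof. by apply/funext => n; rewrite fps_constM /fps_const mulrnAr. Qed.

Lemma fps_constX a m : fps_const (a ^+ m) = fps_const a ^+ m.
Proof. by elim: m => // m IH; rewrite !exprS fps_const_mul IH. Qed.

(** A nonzero constant term makes [ps_inv f] a genuine inverse. Identities between quotients can
    thus be proved with denominators cleared. *)
Lemma fps_mulfI f : f 0%N != 0 -> injective ( *%R f).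
Proof.
move=> f0 g h /(congr1 ( *%R (ps_inv f : fps K))).
by rewrite !mulrA [_ * f]mulrC [f * _](ps_mulV f0) !mul1r.
Qed.

(** This is the substitution of c t for t. *)
Definition fps_dilate (c : K) f : fps K := fun n => c ^+ n * f n.

Lemma fps_dilateM c f g :
  fps_dilate c (f * g) = fps_dilate c f * fps_dilate c g.
Proof.
apply/funext => n; rewrite /fps_dilate !fpsME /ps_mul mulr_sumr.
apply: eq_bigr => -[k kn] _ /=.
by rewrite -{1}(subnKC (n := n) (m := k)) // exprD; ring.
Qed.

Lemma fps_dilateD c f g :
  fps_dilate c (f + g) = fps_dilate c f + fps_dilate c g.
Proof. by apply/funext => n; rewrite /fps_dilate !fpsDE mulrDr. Qed.

Lemma fps_dilate_const c a : fps_dilate c (fps_const a) = fps_const a.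
Proof.
apply/funext => -[|n]; rewrite /fps_dilate /fps_const ?expr0 ?mul1r //=.
by rewrite !mulr0n mulr0.
Qed.

Definition fps_exp (x : K) : fps K := ps_exp x.

Lemma fps_dilate_exp c x : fps_dilate c (fps_exp x) = fps_exp (c * x).
Proof. by apply/funext => n; rewrite /fps_dilate /fps_exp /ps_exp exprMn mulrA. Qed.

Hypothesis char0 : forall n, n.+1%:R != 0 :> K.

Lemma natr_fact_neq0 n : n`!%:R != 0 :> K.
Proof. by rewrite -(prednK (fact_gt0 n)). Qed.

Lemma fps_expD (x y : K) :
  fps_exp (x + y) = fps_exp x * fps_exp y.
Proof.
apply/funext => n; rewrite fpsME /ps_mul /fps_exp /ps_exp addrC exprDn mulr_suml.
apply: eq_bigr => -[k kn] _ /=.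
have <- := bin_fact (n := n) (m := k) kn; rewrite -mulr_natr !natrM.
have := natr_fact_neq0 k; have := natr_fact_neq0 (n - k).
have b0 : 'C(n, k)%:R != 0 :> K by rewrite -(@prednK 'C(n, k)) ?bin_gt0.
by move=> nk0 k0; field; rewrite b0 k0 nk0.
Qed.

Lemma fps_exp0 : fps_exp 0 = 1.
Proof.
apply/funext => -[|n]; rewrite /fps_exp /ps_exp fps1E; first by rewrite expr0 divr1.
by rewrite expr0n /= mul0r.
Qed.

Lemma fps_expMn (x : K) m : fps_exp (m%:R * x) = fps_exp x ^+ m.
Proof.
elim: m => [|m IH]; first by rewrite mul0r fps_exp0 expr0.
by rewrite -natr1 mulrDl mul1r fps_expD IH exprSr.
Qed.

End PowerSeries.

(** With d the square root of c, n c^n = (n d^n) d^n, where the first factor stays bounded and the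
    second tends to 0. *)
Lemma mulrn_exp_small (R : realType) (c e : R) : 0 <= c < 1 -> 0 < e ->
  exists M, forall n, (M <= n)%N -> n%:R * c ^+ n < e.
Proof.
move=> /andP[c0 c1] e0; pose d := Num.sqrt c.
have d0 : 0 <= d := sqrtr_ge0 c.
have dd : d * d = c by rewrite -expr2 sqr_sqrtr.
have d1 : d < 1 by rewrite ltNge; apply/negP => h; nra.
(* n d^n is at most the n-th partial sum of the geometric series of ratio d. *)
have nd n : n%:R * d ^+ n <= (1 - d)^-1.
  rewrite -[(1 - d)^-1]mul1r ler_pdivlMr ?subr_gt0 // mulrC.
  apply: (@le_trans _ _ (1 - d ^+ n)); last by rewrite gerBl exprn_ge0.
  rewrite -[1 - d ^+ n]opprB subrX1 -mulNr opprB ler_wpM2l ?subr_ge0 ?(ltW d1) //.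
  have -> : n%:R * d ^+ n = \sum_(i < n) d ^+ n.
    by rewrite sumr_const card_ord mulr_natl.
  apply: ler_sum => i _.
  by apply: ler_wiXn2l; rewrite ?(ltW d1) // ltnW.
(* The factor 1 - d compensates the bound 1 / (1 - d) on n d^n. *)
have [M _ hM] : exists2 M, True & forall n, (M <= n)%N -> d ^+ n < e * (1 - d).
  have /cvgrPdist_lt/(_ (e * (1 - d))) : ((d ^+ n : R) @[n --> \oo] --> 0)%classic.
    by apply: cvg_expr; rewrite ger0_norm.
  rewrite mulr_gt0 ?subr_gt0 // => /(_ isT)[M _ hM]; exists M => // n /hM /=.
  by rewrite sub0r normrN ger0_norm // exprn_ge0.
exists M => n /hM; rewrite -ltr_pdivrMr ?subr_gt0 //; apply: le_lt_trans.
by rewrite -dd exprMn mulrA mulrC ler_wpM2l ?exprn_ge0.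
Qed.

(** * Truncated logarithms as polynomials: [log_poly N] is L_N, and [log_defect N W] is P with w =
    [W] *)

Section Logarithm.
Variable K : fieldType.
Implicit Types N W : nat.

Definition log_poly N : {poly K} :=
  \sum_(1 <= k < N.+1) ((-1) ^+ k.+1 / k%:R) *: 'X^k.

Lemma log_polyE N x : (log_poly N).[x] =
  \sum_(1 <= k < N.+1) (-1) ^+ k.+1 * x ^+ k / k%:R.
Proof.
rewrite horner_sum; apply: eq_bigr => k _.
by rewrite hornerZ hornerXn mulrAC.
Qed.

Hypothesis char0 : forall n, n.+1%:R != 0 :> K.

(** The term of degree N + 1 has derivative (-X)^N, so multiplication by 1 + X makes the sum
    telescope. *)
Lemma deriv_log_poly N : (log_poly N)^`() * (1 + 'X) = 1 - (- 'X) ^+ N.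
Proof.
elim: N => [|N IH]; first by rewrite /log_poly big_geq // deriv0 mul0r expr0 subrr.
rewrite /log_poly big_nat_recr //= derivD mulrDl IH derivZ derivXn /=.
rewrite -scaler_nat scalerA divfK // !exprS mulrA mulrNN !mul1r -mul_polyC rmorphXn /=.
by rewrite polyCN [(- 'X) ^+ N]exprNn; ring.
Qed.


(** The factor 1 + X is a unit modulo X^N; concretely, coefficient i of f (1 + X) is f_i + f_(i-1),
    and induction applies. *)
Lemma dvdXn_coef0 N (f g : {poly K}) i : (i < N)%N ->
  f * (1 + 'X) = 'X^N * g -> f`_i = 0.
Proof.
move=> iN e; have : (f * (1 + 'X))`_i = 0 by rewrite e coefXnM iN.
elim: i iN => [|i IH] iN; rewrite mulrDr mulr1 coefD coefMX /=.
  by rewrite addr0.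
by rewrite IH ?addr0 // 1?ltnW // e coefXnM ltnW.
Qed.

Lemma deriv_coef0 N (f : {poly K}) i : (i <= N)%N -> f.[0] = 0 ->
  (forall j, (j < N)%N -> f^`()`_j = 0) -> f`_i = 0.
Proof.
case: i => [|i] iN f0 f'0; first by rewrite -horner_coef0.
have := f'0 i iN; rewrite coef_deriv -mulr_natr => /eqP.
by rewrite mulf_eq0 (negPf (char0 i)) orbF => /eqP.
Qed.

Definition log_defect N W : {poly K} :=
  log_poly N \Po ((1 + 'X) ^+ W - 1) - W%:R *: log_poly N.

Lemma log_defectE N W x : (log_defect N W).[x] =
  (log_poly N).[(1 + x) ^+ W - 1] - W%:R * (log_poly N).[x].
Proof. by rewrite /log_defect !hornerE horner_comp !hornerE. Qed.

Lemma log_defect_coef0 N W i : (i <= N)%N -> (log_defect N W)`_i = 0.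
Proof.
move=> iN; have L0 : (log_poly N).[0] = 0.
  rewrite log_polyE big_nat big1 // => k /andP[k0 _].
  by rewrite expr0n eqn0Ngt k0 mulr0 mul0r.
apply: deriv_coef0 iN _ _ => [|j jN].
  by rewrite log_defectE addr0 expr1n subrr L0 mulr0 subrr.
pose S : {poly K} := \sum_(i < W) (1 + 'X) ^+ i.
(* With Y = (1 + X)^W - 1 = X S, the chain rule gives (1 + X) P' = W ((-X)^N - (-Y)^N); the witness
   is what remains after extracting X^N. *)
apply: (@dvdXn_coef0 N _ (W%:R *: ((-1) ^+ N - (- S) ^+ N))) jN _.
set Y := (1 + 'X) ^+ W - 1 : {poly K}.
have YE : Y = 'X * S by rewrite /Y subrX1 addrAC subrr add0r.
have Y' : Y^`() * (1 + 'X) = W%:R *: (1 + Y).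
  rewrite /Y derivB deriv_exp !derivD derivX !derivC add0r subr0 mul1r.
  case: (W) => [|w]; first by rewrite mulr0n mul0r scale0r.
  by rewrite mulrnAl -exprSr scaler_nat addrCA subrr addr0.
rewrite /log_defect derivB derivZ deriv_comp mulrBl -/Y -scalerAl deriv_log_poly.
rewrite -mulrA Y' -scalerAr.
have -> : ((log_poly N)^`() \Po Y) * (1 + Y) = 1 - (- Y) ^+ N.
  have := congr1 (fun f => f \Po Y) (deriv_log_poly N).
  rewrite /= rmorphM rmorphD rmorphB rmorphXn rmorphN !rmorph1 /=.
  by rewrite !comp_polyX.
rewrite -scalerBr -scalerAr YE -mulrN exprMn [(- 'X) ^+ N]exprNn.
by congr (_ *: _); ring.
Qed.

End Logarithm.

(** * The absolute value on integers and its ultrametric estimates *)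

Section Ultrametric.
Variables (R : realType) (p : nat) (K : fieldType) (abs : K -> R).
Hypotheses (p_pr : prime p) (CK : is_Cp p abs).
Implicit Types (x y z : K) (c e : R) (m n k N W : nat) (f g : {poly K}).

Local Notation abs_ge0 := (Cp_abs_ge0 CK).
Local Notation absM := (Cp_absM CK).

Lemma abs0 : abs 0 = 0.
Proof. exact/(Cp_abs_eq0 CK). Qed.

Lemma abs1 : abs 1 = 1.
Proof.
have a1 : abs 1 != 0 by apply/eqP => /(Cp_abs_eq0 CK)/eqP; rewrite oner_eq0.
by apply: (mulfI a1); rewrite -absM !mulr1.
Qed.

Lemma absX x n : abs (x ^+ n) = abs x ^+ n.
Proof. by elim: n => [|n IH]; rewrite ?expr0 ?abs1 // !exprS absM IH. Qed.

Lemma absN x : abs (- x) = abs x.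
Proof.
apply/eqP; rewrite -(@eqrXn2 _ 2) ?abs_ge0 //.
by rewrite -!absX sqrrN.
Qed.

Lemma absV x : abs x^-1 = (abs x)^-1.
Proof.
have [->|x0] := eqVneq x 0; first by rewrite invr0 abs0 invr0.
have ax0 : abs x != 0 by apply: contra x0 => /eqP/(Cp_abs_eq0 CK) ->.
by apply: (mulfI ax0); rewrite -absM !mulfV ?abs1.
Qed.

Lemma absD_le x y c : abs x <= c -> abs y <= c -> abs (x + y) <= c.
Proof. by move=> xc yc; apply: le_trans (Cp_absD CK x y) _; rewrite ge_max xc. Qed.

Lemma absD_lt x y c : abs x < c -> abs y < c -> abs (x + y) < c.
Proof. by move=> xc yc; apply: le_lt_trans (Cp_absD CK x y) _; rewrite gt_max xc. Qed.

Lemma abs_sum_le (I : Type) (r : seq I) (P : pred I) (F : I -> K) c : 0 <= c ->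
  (forall i, P i -> abs (F i) <= c) -> abs (\sum_(i <- r | P i) F i) <= c.
Proof.
move=> c0 Fc; apply: (big_ind (fun x => abs x <= c)) => //; first by rewrite abs0.
by move=> x y; exact: absD_le.
Qed.

Lemma abs_nat_le1 n : abs n%:R <= 1.
Proof.
by elim: n => [|n IH]; rewrite ?abs0 // -natr1 absD_le // abs1.
Qed.

Lemma abs_sign n : abs ((-1) ^+ n) = 1.
Proof. by rewrite absX absN abs1 expr1n. Qed.

(** In a Bezout relation 1 = a n - b p the term b p has absolute value below 1, so |n| < 1 would
    force |1| < 1. *)
Lemma abs_nat_coprime n : coprime p n -> abs n%:R = 1.
Proof.
move=> cpn; apply/eqP; rewrite eq_le abs_nat_le1 /= leNgt; apply/negP => n1.
have n0 : (0 < n)%N.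
  by move: cpn; case: n {n1} => //; rewrite /coprime gcdn0 => /eqP p1; move: p_pr; rewrite p1.
have [a b eab _] := egcdnP p n0.
move: cpn; rewrite coprime_sym => /eqP cnp; rewrite cnp in eab.
have : 1 = a%:R * n%:R - b%:R * p%:R :> K.
  by rewrite -!natrM eab natrD addrAC subrr add0r.
move=> /(congr1 abs); rewrite abs1 => e1.
have : abs (a%:R * n%:R - b%:R * p%:R) < 1.
  apply: absD_lt; rewrite ?absN absM.
    by apply: le_lt_trans n1; rewrite ler_piMl ?abs_ge0 ?abs_nat_le1.
  rewrite (Cp_absp CK) (@le_lt_trans _ _ p%:R^-1) //.
    by rewrite ler_piMl ?abs_nat_le1 ?invr_ge0.
  by rewrite invf_lt1 ?ltr1n ?ltr0n ?prime_gt1 ?prime_gt0.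
by rewrite -e1 ltxx.
Qed.

(** Only the p-part of n contributes: |1/n| is the largest power of p dividing n. Hence the
    denominators of the logarithm grow at most linearly. *)
Lemma abs_natV_le n : (0 < n)%N -> abs n%:R^-1 <= n%:R.
Proof.
move=> n0; rewrite absV; have [m cpm nE] := pfactor_coprime p_pr n0.
have m0 : (0 < m)%N by move: n0; rewrite nE muln_gt0 => /andP[].
rewrite {1}nE natrM natrX absM absX (Cp_absp CK) abs_nat_coprime // mul1r.
by rewrite exprVn invrK -natrX ler_nat {2}nE leq_pmull.
Qed.

(** * Powers of elements close to 1, and the absence of roots of unity there *)

Lemma abs_subX1_le z n : abs (z - 1) <= 1 -> abs (z ^+ n - 1) <= abs (z - 1).
Proof.
move=> z1; have az : abs z <= 1 by rewrite -[z](subrK 1) absD_le ?abs1.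
rewrite subrX1 absM ler_piMr ?abs_ge0 // abs_sum_le // => i _.
by rewrite absX exprn_ile1 ?abs_ge0.
Qed.

Lemma abs_lt1_of_exp z : abs z ^+ p.-1 < p%:R^-1 -> abs z < 1.
Proof.
move=> h; rewrite ltNge; apply/negP => z1; move: h; apply/negP; rewrite -leNgt.
rewrite (@le_trans _ _ 1) ?exprn_ege1 // invf_le1 ?ltr0n ?prime_gt0 //.
by rewrite ler1n prime_gt0.
Qed.

Lemma prime_exp_neq1 l z : prime l -> z != 1 ->
  abs (z - 1) ^+ p.-1 < p%:R^-1 -> z ^+ l != 1.
Proof.
move=> l_pr z1 zp; have z_lt1 := abs_lt1_of_exp zp.
(* For l different from p, the cofactor of z - 1 is l plus the sum of the z^i - 1, and |l| = 1
   exceeds the absolute value of that sum. *)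
have [->{l l_pr}|lp] := eqVneq l p; last first.
  rewrite -subr_eq0 subrX1 mulf_neq0 ?subr_eq0 //; apply/eqP => s0.
  have : abs l%:R <= abs (z - 1).
    have -> : l%:R = - \sum_(i < l) (z ^+ i - 1).
      by rewrite sumrB s0 sub0r opprK sumr_const card_ord.
    by rewrite absN abs_sum_le ?abs_ge0 // => i _; rewrite abs_subX1_le // ltW.
  rewrite abs_nat_coprime ?leNgt ?z_lt1 //.
  by rewrite prime_coprime // dvdn_prime2 // eq_sym.
pose x := z - 1; have x0 : x != 0 by rewrite subr_eq0.
have zE : z ^+ p = 1 + x * \sum_(i < p) x ^+ i *+ 'C(p, i.+1).
  rewrite -[z](subrK 1) -/x addrC exprDn big_ord_recl /= subn0 bin0 expr0.
  rewrite mulr1 expr1n mulr_sumr; congr (_ + _); apply: eq_bigr => i _.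
  by rewrite expr1n mul1r mulrnAr -exprS.
rewrite zE -subr_eq0 addrAC subrr add0r mulf_neq0 //; apply/eqP.
have [r Ep] : exists r, p = r.+2.
  by exists p.-2; have := prime_gt1 p_pr; case: (p) => [|[]].
rewrite Ep big_ord_recl expr0 bin1 => /eqP; rewrite addr_eq0 => /eqP pE.
(* For l = p, the cofactor of x is p plus terms with binomials divisible by p, of size at most |x| /
   p, plus the last term x^(p-1). Both bounds lie below |p| = 1/p, so the cofactor cannot vanish. *)
pose c := Num.max (abs x / p%:R) (abs x ^+ p.-1).
have p0 : 0 < p%:R^-1 :> R by rewrite invr_gt0 ltr0n prime_gt0.
have cp : c < p%:R^-1 by rewrite gt_max zp andbT gtr_pMl.
have : abs r.+2%:R <= c.
  rewrite pE absN; apply: abs_sum_le => [|i _].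
    by rewrite le_max exprn_ge0 ?abs_ge0 ?orbT.
  rewrite lift0 -mulr_natr absM absX le_max.
  have [/= ir|ir] := ltnP i.+2 r.+2; last first.
    have -> : i = r :> nat by apply/eqP; rewrite eqn_leq -ltnS ltn_ord.
    by rewrite binn abs1 mulr1 Ep lexx orbT.
  have /dvdnP[b ->] : (p %| 'C(r.+2, i.+2))%N.
    by rewrite -Ep prime_dvd_bin // Ep.
  rewrite natrM absM (Cp_absp CK) mulrA ler_wpM2r ?(ltW p0) //.
  rewrite (@le_trans _ _ (abs x ^+ i.+1)) //.
    by rewrite ler_piMr ?exprn_ge0 ?abs_ge0 ?abs_nat_le1.
  by rewrite exprS ler_piMr ?abs_ge0 // exprn_ile1 ?abs_ge0 // ltW.
by rewrite -Ep (Cp_absp CK) leNgt cp.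
Qed.

(** Strong induction on the exponent: a prime factor l of W is split off, and z^l again lies in the
    disc and differs from 1. *)
Lemma exp_neq1 W z : (0 < W)%N -> z != 1 ->
  abs (z - 1) ^+ p.-1 < p%:R^-1 -> z ^+ W != 1.
Proof.
elim/ltn_ind: W z => W IH z W0 z1 zp.
have [->|W1] := eqVneq W 1%N; first by rewrite expr1.
have Wgt1 : (1 < W)%N by rewrite ltn_neqAle eq_sym W1.
have l_pr := pdiv_prime Wgt1; have lW := pdiv_dvd W.
rewrite -(divnK lW) mulnC exprM.
have W'lt : (W %/ pdiv W < W)%N by rewrite ltn_Pdiv ?prime_gt1.
have W'0 : (0 < W %/ pdiv W)%N by rewrite divn_gt0 ?prime_gt0 // dvdn_leq.
apply: (IH _ W'lt _ W'0); first exact: prime_exp_neq1.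
have zl := abs_subX1_le (pdiv W) (ltW (abs_lt1_of_exp zp)).
by apply: le_lt_trans zp; apply: lerXn2r; rewrite ?nnegrE ?abs_ge0.
Qed.

(** Raising to the power p - 1 trades the real exponent in the radius for an integer one, the form
    used by the other estimates. *)
Lemma abs_exp_lt z : abs z < p%:R `^ (- 1 / (p%:R - 1)) ->
  abs z ^+ p.-1 < p%:R^-1.
Proof.
have p1 := prime_gt1 p_pr; have pE : p%:R - 1 = p.-1%:R :> R.
  by rewrite -{1}(prednK (ltnW p1)) -natr1 addrK.
have p10 : (0 < p.-1)%N by rewrite -ltnS prednK // ltnW.
move=> zlt; have -> : p%:R^-1 = (p%:R `^ (- 1 / (p%:R - 1))) ^+ p.-1 :> R.
  rewrite -powR_mulrn ?powR_ge0 // -powRrM -pE divfK ?powR_inv1 //.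
  by rewrite pE pnatr_eq0 -lt0n.
by rewrite ltrXn2r ?nnegrE ?abs_ge0 ?powR_ge0 ?gtn_eqF.
Qed.

(** * Gauss norm bounds, convergence of the logarithm and its behaviour on powers *)

Definition coef_le c f := forall i, abs f`_i <= c.

Lemma coef_le1D f g : coef_le 1 f -> coef_le 1 g -> coef_le 1 (f + g).
Proof. by move=> hf hg i; rewrite coefD absD_le. Qed.

Lemma coef_leM1 c f g : 0 <= c -> coef_le c f -> coef_le 1 g -> coef_le c (f * g).
Proof.
move=> c0 hf hg i; rewrite coefM abs_sum_le // => j _.
by rewrite absM -[c]mulr1 ler_pM ?abs_ge0.
Qed.

Lemma coef_le1_1 : coef_le 1 1.
Proof. by move=> i; rewrite coef1; case: (_ == _); rewrite ?abs1 ?abs0. Qed.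

Lemma coef_le1X n f : coef_le 1 f -> coef_le 1 (f ^+ n).
Proof.
move=> hf; elim: n => [|n IH]; first by rewrite expr0; exact: coef_le1_1.
by rewrite exprS; apply: coef_leM1.
Qed.

(** Powers of f keep Gauss norm at most 1, so only the denominators k <= N matter, and |1/k| <= k <=
    N. *)
Lemma coef_le_log_comp N f : coef_le 1 f -> coef_le N%:R (log_poly K N \Po f).
Proof.
move=> hf i; rewrite /log_poly rmorph_sum /= coef_sum big_nat abs_sum_le //.
move=> k /andP[k0 kN]; rewrite comp_polyZ comp_Xn_poly coefZ absM absM abs_sign.
rewrite mul1r -[N%:R]mulr1 ler_pM ?abs_ge0 //; last exact: coef_le1X.
by apply: le_trans (abs_natV_le k0) _; rewrite ler_nat -ltnS.
Qed.

Lemma coef_le_log_defect N W : coef_le N%:R (log_defect K N W).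
Proof.
have X1 : coef_le 1 'X.
  by move=> i; rewrite coefX; case: (_ == _); rewrite ?abs1 ?abs0.
move=> i; rewrite coefB absD_le ?absN.
- by [].
- apply: coef_le_log_comp; apply: coef_le1D.
    by apply: coef_le1X; apply: coef_le1D => //; exact: coef_le1_1.
  by move=> j; rewrite coefN absN coef_le1_1.
- rewrite coefZ absM -[X in _ <= X]mul1r ler_pM ?abs_ge0 ?abs_nat_le1 //.
  by rewrite -[log_poly K N]comp_polyXr coef_le_log_comp.
Qed.

Lemma abs_log_defect N W x : abs x <= 1 ->
  abs (log_defect K N W).[x] <= N%:R * abs x ^+ N.
Proof.
move=> x1; rewrite horner_coef abs_sum_le //.
  by rewrite mulr_ge0 ?exprn_ge0 ?abs_ge0.
move=> i _; have [iN|Ni] := leqP i N.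
  rewrite log_defect_coef0 //; last exact: Cp_char0 p_pr CK.
  by rewrite mul0r abs0 mulr_ge0 ?exprn_ge0 ?abs_ge0.
rewrite absM absX ler_pM ?exprn_ge0 ?abs_ge0 ?coef_le_log_defect //.
by apply: ler_wiXn2l; rewrite ?abs_ge0 // ltnW.
Qed.

Lemma log_poly_cvg z : abs (z - 1) < 1 ->
  abs_cvg abs (fun N => (log_poly K N).[z - 1]) (plog abs z).
Proof.
move=> z1; have /(Cp_complete CK)[l hl] :
    abs_cauchy abs (fun N => (log_poly K N).[z - 1]).
  move=> e e0; have e20 : 0 < e / 2 by rewrite divr_gt0.
  have [|M hM] := @mulrn_exp_small R (abs (z - 1)) (e / 2) _ e20.
    by rewrite abs_ge0.
  exists M => m n; wlog mn : m n / (m <= n)%N => [H Mm Mn|Mm Mn].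
    have [mn|/ltnW nm] := leqP m n; first exact: H.
    by rewrite -absN opprB; apply: H.
  (* The ultrametric bound on the block of terms is non-strict, whence the margin e / 2. *)
  apply: (@le_lt_trans _ _ (e / 2)); last by rewrite ltr_pdivrMr // ltr_pMr // ltr1n.
  rewrite -absN opprB !log_polyE (@big_cat_nat _ _ _ m.+1) //= addrAC subrr add0r.
  rewrite big_nat abs_sum_le ?(ltW e20) // => k /andP[mk kn].
  rewrite absM absM abs_sign mul1r absX mulrC.
  have k0 : (0 < k)%N := leq_ltn_trans (leq0n m) mk.
  apply: le_trans (ltW (hM k _)); last by rewrite (leq_trans Mm) // ltnW.
  by rewrite ler_wpM2r ?exprn_ge0 ?abs_ge0 // abs_natV_le.
(* Since a limit exists, [xget] selects a genuine limit and not its default value 0. *)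
rewrite /plog; set S := (X in xget 0 X).
have Sl : S l by move=> e /hl[N hN]; exists N => n /hN; rewrite log_polyE.
have := xgetPex 0 (ex_intro _ l Sl); rewrite -/S => h e /h[N hN].
by exists N => n /hN; rewrite log_polyE.
Qed.

Lemma abs_cvg_unique (u : nat -> K) l1 l2 :
  abs_cvg abs u l1 -> abs_cvg abs u l2 -> l1 = l2.
Proof.
move=> h1 h2; apply/eqP; rewrite -subr_eq0; apply: contraT => d0.
(* The radius |l1 - l2| itself suffices: by the ultrametric inequality, two strict bounds by it
   already contradict each other. *)
have a0 : 0 < abs (l1 - l2).
  rewrite lt_neqAle abs_ge0 andbT eq_sym.
  by apply: contra d0 => /eqP/(Cp_abs_eq0 CK) ->.
have [N1 /(_ (maxn N1 _) (leq_maxl _ _)) H1] := h1 _ a0.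
have [N2 /(_ (maxn _ N2) (leq_maxr _ _)) H2] := h2 _ a0.
have := absD_lt (x := - (u (maxn N1 N2) - l1)) (y := u (maxn N1 N2) - l2) _ (H2 N1).
by rewrite absN opprB addrA subrK ltxx => /(_ (H1 N2)).
Qed.

Lemma plogX z W : abs (z - 1) < 1 -> plog abs (z ^+ W) = W%:R * plog abs z.
Proof.
move=> z1; have zW1 : abs (z ^+ W - 1) < 1.
  exact: le_lt_trans (abs_subX1_le W (ltW z1)) z1.
apply: abs_cvg_unique (log_poly_cvg zW1) _ => e e0.
have [N1 h1] := log_poly_cvg z1 e0.
have [|N2 h2] := @mulrn_exp_small R (abs (z - 1)) e _ e0; first by rewrite abs_ge0.
exists (maxn N1 N2) => n; rewrite geq_max => /andP[/h1 {}h1 /h2 {}h2].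
(* The error splits into the defect polynomial at z - 1 and W times the truncation error of log z,
   so W log z is also a limit for z^W. *)
have -> : (log_poly K n).[z ^+ W - 1] - W%:R * plog abs z =
    (log_defect K n W).[z - 1] + W%:R * ((log_poly K n).[z - 1] - plog abs z).
  by rewrite log_defectE [1 + _]addrC subrK; ring.
apply: absD_lt; first by apply: le_lt_trans (abs_log_defect _ _ (ltW z1)) h2.
by rewrite absM; apply: le_lt_trans h1; rewrite ler_piMl ?abs_ge0 ?abs_nat_le1.
Qed.

End Ultrametric.

(** * Generating functions of the q-Bernoulli sums and their cyclic symmetry *)

Section Bernoulli.
Variables (R : realType) (p : nat) (K : fieldType) (abs : K -> R).
Hypotheses (p_pr : prime p) (CK : is_Cp p abs).
Variables (q y : K).
Hypotheses (q1 : q != 1) (hq : abs (q - 1) ^+ p.-1 < p%:R^-1).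

Let char0 := Cp_char0 p_pr CK.

Definition fpsX : fps K := fun n => 1 *+ (n == 1%N).

(** The constant term of Q e^t - 1 is Q - 1, so for Q different from 1 [ps_inv] really inverts
    it. *)
Lemma qbern_gen_mul Q : Q != 1 ->
  (qbern_gen abs Q : fps K) * (fps_const Q * fps_exp 1 - 1) =
  fps_const (plog abs Q) + fpsX.
Proof.
move=> Q1; set D := fps_const Q * fps_exp 1 - 1.
have DE : D = (fun n => Q * ps_exp 1 n - 1 *+ (n == 0%N)).
  by apply/funext => n; rewrite /D fpsDE fps_constM.
have D0 : D 0%N != 0 by rewrite DE /ps_exp expr0 divr1 mulr1 subr_eq0.
have DV : (ps_inv D : fps K) * D = 1 by rewrite mulrC; exact: ps_mulV.
by rewrite /qbern_gen -DE -[ps_mul _ _]/((fps_const _ + fpsX) * (ps_inv D : fps K))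
  -mulrA DV mulr1.
Qed.

Definition qexp : fps K := fps_const q * fps_exp 1.

Lemma qexpX m : qexp ^+ m = fps_const (q ^+ m) * fps_exp m%:R.
Proof. by rewrite exprMn fps_constX -fps_expMn // mulr1. Qed.

Lemma qexpX_sub1_0 m : (0 < m)%N -> (qexp ^+ m - 1) 0%N != 0.
Proof.
move=> m0; rewrite qexpX fpsDE fps_constM fpsNE fps1E.
rewrite /fps_exp /ps_exp expr0 divr1 mulr1 subr_eq0.
exact: exp_neq1 p_pr CK _ _ m0 q1 hq.
Qed.

(** Substituting W t for t turns q^W e^t into E^W, where E is [qexp], and, by [plogX], log(q^W) + t
    into W (log q + t). *)
Lemma qbern_gen_dilate W : (0 < W)%N ->
  fps_dilate W%:R (qbern_gen abs (q ^+ W)) * (qexp ^+ W - 1) =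
  fps_const W%:R * (fps_const (plog abs q) + fpsX).
Proof.
move=> W0; have qW1 := exp_neq1 p_pr CK W0 q1 hq.
have := congr1 (fps_dilate W%:R) (qbern_gen_mul qW1).
rewrite fps_dilateM !fps_dilateD fps_dilateM fps_dilate_exp mulr1.
rewrite !fps_dilate_const -qexpX.
have -> : fps_dilate W%:R (- 1) = - 1 :> fps K.
  have -> : - 1 = fps_const (- 1) :> fps K.
    by apply/funext => n; rewrite fpsNE fps1E /fps_const mulNrn.
  by rewrite fps_dilate_const.
move=> ->; rewrite (plogX p_pr CK) ?(abs_lt1_of_exp p_pr hq) //.
rewrite mulrDr fps_const_mul; congr (_ + _); apply/funext => n.
rewrite fps_constM /fps_dilate /fpsX.
by case: eqVneq => [->|_]; rewrite ?expr1 // !mulr0n !mulr0.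
Qed.

Definition qbern_sum (w1 w2 w3 n : nat) : K :=
  (w1 * w2)%:R ^ (n%:Z - 1) *
    (\sum_(i < w1) \sum_(j < w2)
      q ^+ (w2 * w3 * i + w1 * w3 * j) *
      (qbern_poly abs (q ^+ (w1 * w2)) n).[
         w3%:R * y + w3%:R / w1%:R * i%:R + w3%:R / w2%:R * j%:R]).

Definition qbern_sum_gen w1 w2 w3 : fps K :=
  fun n => qbern_sum w1 w2 w3 n / n`!%:R.

(** The extra factor w1 w2 raises (w1 w2)^(n-1) to (w1 w2)^n, which is a dilation; the double sum
    then factors into two geometric sums in E. *)
Lemma qbern_sum_genE w1 w2 w3 : (0 < w1)%N -> (0 < w2)%N ->
  fps_const (w1 * w2)%:R * qbern_sum_gen w1 w2 w3 =
  fps_dilate (w1 * w2)%:R (qbern_gen abs (q ^+ (w1 * w2))) *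
    fps_exp ((w1 * w2 * w3)%:R * y) *
    (\sum_(i < w1) (qexp ^+ (w2 * w3)) ^+ i) *
    (\sum_(j < w2) (qexp ^+ (w1 * w3)) ^+ j).
Proof.
move=> w10 w20; have nz w : (0 < w)%N -> w%:R != 0 :> K by case: w.
have [w1N w2N] := (nz _ w10, nz _ w20); set W := (w1 * w2)%N.
have WN : W%:R != 0 :> K by rewrite nz ?muln_gt0 ?w10.
rewrite -mulrA big_distrlr /= mulr_sumr; apply/funext => n.
(* The exponent n - 1 is an integer, equal to -1 at n = 0; splitting it relies on w1 w2 being
   nonzero in [K]. *)
rewrite fps_constM fps_sumE /qbern_sum_gen /qbern_sum expfzDr // exprN1.
rewrite [_ ^ n%:Z * _]mulrC -!mulrA mulVKf // mulr_suml mulr_sumr.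
apply: eq_bigr => i _; rewrite mulr_suml !mulr_sumr fps_sumE.
apply: eq_bigr => j _; rewrite -!exprM -exprD.
set m := (_ + _)%N; set x := _ + w3%:R / w2%:R * _.
(* The same [m] occurs here and in the power of q, so q^m e^(m t) recombines into E^m. *)
have Wx : W%:R * x = (W * w3)%:R * y + m%:R.
  by rewrite /x /m /W !natrD !natrM; field; rewrite w1N w2N.
transitivity (q ^+ m * fps_dilate W%:R (ps_mul (qbern_gen abs (q ^+ W)) (ps_exp x)) n).
  by rewrite (qbern_polyE _ _ p_pr CK) /fps_dilate -exprnP -/W; ring.
rewrite -fps_constM.
rewrite -[ps_mul _ _]/((qbern_gen abs (q ^+ W) : fps K) * fps_exp x).
rewrite fps_dilateM fps_dilate_exp Wx fps_expD // qexpX.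
by rewrite mulrCA [fps_const _ * (_ * _)]mulrCA mulrA.
Qed.

(** One factor on the left cancels the denominator of the dilated generating function; each of the
    other two completes a geometric sum to E^(w1 w2 w3) - 1. *)
Lemma qbern_sum_gen_closed w1 w2 w3 :
  (0 < w1)%N -> (0 < w2)%N -> (0 < w3)%N ->
  (qexp ^+ (w1 * w2) - 1) * (qexp ^+ (w2 * w3) - 1) * (qexp ^+ (w1 * w3) - 1)
    * qbern_sum_gen w1 w2 w3 =
  (fps_const (plog abs q) + fpsX) * fps_exp ((w1 * w2 * w3)%:R * y)
    * (qexp ^+ (w1 * w2 * w3) - 1) ^+ 2.
Proof.
move=> w10 w20 w30; have W0 : (0 < w1 * w2)%N by rewrite muln_gt0 w10.
apply: (@fps_mulfI _ (fps_const (w1 * w2)%:R)).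
  by rewrite /fps_const; case: (w1 * w2)%N W0 => // k _; exact: char0.
have e1 : qexp ^+ (w1 * w2 * w3) - 1 =
    (qexp ^+ (w2 * w3) - 1) * \sum_(i < w1) (qexp ^+ (w2 * w3)) ^+ i.
  by rewrite -subrX1 -exprM -mulnA mulnC.
have e2 : qexp ^+ (w1 * w2 * w3) - 1 =
    (qexp ^+ (w1 * w3) - 1) * \sum_(i < w2) (qexp ^+ (w1 * w3)) ^+ i.
  by rewrite -subrX1 -exprM mulnAC.
rewrite mulrCA qbern_sum_genE // expr2 !mulrA -(qbern_gen_dilate W0).
by rewrite {1}e1 e2; ring.
Qed.

Lemma qbern_sum_rot w1 w2 w3 n : (0 < w1)%N -> (0 < w2)%N -> (0 < w3)%N ->
  qbern_sum w1 w2 w3 n = qbern_sum w2 w3 w1 n.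
Proof.
move=> w10 w20 w30.
have h1 := qbern_sum_gen_closed w10 w20 w30.
have h2 := qbern_sum_gen_closed w20 w30 w10.
have e123 : (w2 * w3 * w1 = w1 * w2 * w3)%N by rewrite mulnC mulnA.
(* The right-hand sides of the two closed forms agree, so [h2] now equates the two cleared left-hand
   sides, whose common factor [D] is cancellable. *)
rewrite e123 -h1 [(w2 * w1)%N]mulnC [(w3 * w1)%N]mulnC in h2.
pose D := (qexp ^+ (w1 * w2) - 1) * (qexp ^+ (w2 * w3) - 1)
  * (qexp ^+ (w1 * w3) - 1).
have D0 : D 0%N != 0.
  by rewrite /D !fpsM0 !mulf_neq0 ?qexpX_sub1_0 ?muln_gt0 ?w10 ?w20 ?w30.
have : qbern_sum_gen w1 w2 w3 = qbern_sum_gen w2 w3 w1.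
  by apply: (fps_mulfI D0); rewrite -h2 /D; ring.
move=> /(congr1 (fun f => f n)); apply: mulIf.
by rewrite invr_eq0 natr_fact_neq0.
Qed.

End Bernoulli.

Theorem theorem4p14 (R : realType) (p : nat) (hp : prime p)
    (Cp : fieldType) (abs : Cp -> R) (hCp : is_Cp p abs)
    (q : Cp) (hq1 : q <> 1)
    (hq : abs (q - 1) < p%:R `^ (- 1 / (p%:R - 1)))
    (w1 w2 w3 : nat) (hw1 : (0 < w1)%N) (hw2 : (0 < w2)%N) (hw3 : (0 < w3)%N)
    (n : nat) (y1 : Cp) (hy1 : padicZ abs y1) :
  (w1 * w2)%:R ^ (n%:Z - 1) *
    (\sum_(i < w1) \sum_(j < w2)
      q ^+ (w2 * w3 * i + w1 * w3 * j) *
      (qbern_poly abs (q ^+ (w1 * w2)) n).[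
         w3%:R * y1 + w3%:R / w1%:R * i%:R + w3%:R / w2%:R * j%:R])
  = (w2 * w3)%:R ^ (n%:Z - 1) *
    (\sum_(i < w2) \sum_(j < w3)
      q ^+ (w1 * w3 * i + w1 * w2 * j) *
      (qbern_poly abs (q ^+ (w2 * w3)) n).[
         w1%:R * y1 + w1%:R / w2%:R * i%:R + w1%:R / w3%:R * j%:R])
  /\
  (w2 * w3)%:R ^ (n%:Z - 1) *
    (\sum_(i < w2) \sum_(j < w3)
      q ^+ (w1 * w3 * i + w1 * w2 * j) *
      (qbern_poly abs (q ^+ (w2 * w3)) n).[
         w1%:R * y1 + w1%:R / w2%:R * i%:R + w1%:R / w3%:R * j%:R])
  = (w3 * w1)%:R ^ (n%:Z - 1) *
    (\sum_(i < w3) \sum_(j < w1)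
      q ^+ (w1 * w2 * i + w2 * w3 * j) *
      (qbern_poly abs (q ^+ (w1 * w3)) n).[
         w2%:R * y1 + w2%:R / w3%:R * i%:R + w2%:R / w1%:R * j%:R]).
Proof.
have q1 : q != 1 by apply/eqP.
have qp := abs_exp_lt hp hCp hq.
have rot a b c := qbern_sum_rot hp hCp y1 q1 qp (w1 := a) (w2 := b) (w3 := c) n.
have := rot w1 w2 w3 hw1 hw2 hw3; have := rot w2 w3 w1 hw2 hw3 hw1.
(* The three members are successive rotations of [qbern_sum], up to the order of products of two
   weights. *)
rewrite /qbern_sum [(w3 * w1)%N]mulnC [(w2 * w1)%N]mulnC [(w3 * w2)%N]mulnC.
by move=> -> ->.
Qed.
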